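(* Let $P$ be a poset, $Q$ a finite poset, $M$ a $P$-module and $N$ a $Q$-module, and let $\pi:P\to Q$ be a covering that is Con-rank-preserving. Then the Con-GRI $\mathrm{rk}_M^{\mathrm{Con}}$ of $M$ is Möbius invertible, and for $I\in\mathrm{Con}(P)$, $$\mathrm{dgm}_M(I)=\begin{cases}\mathrm{dgm}_N(\pi(I)),&\text{if } I \text{ is a connected component of } \pi^{-1}(\pi(I)),\\ 0,&\text{otherwise,}\end{cases}$$ where $\mathrm{dgm}_M$ and $\mathrm{dgm}_N$ denote the Möbius inversions of $\mathrm{rk}_M^{\mathrm{Con}}$ and $\mathrm{rk}_N^{\mathrm{Con}}$. Also, the analogous statement with Int in place of Con holds under the extra assumption that $\pi$ is interval-preserving: if $\pi$ is a covering that is interval-preserving and Int-rank-preserving, then $\mathrm{rk}_M^{\mathrm{Int}}$ is Möbius invertible, and for $I\in \mathrm{Int}(P)$ the same formula holds with $\mathrm{dgm}_M$ and $\mathrm{dgm}_N$ denoting the Möbius inversions of $\mathrm{rk}_M^{\mathrm{Int}}$ and $\mathrm{rk}_N^{\mathrm{Int}}$.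
   Context: Fix a field $k$; $\mathbf{vec}$ is the category of finite-dimensional $k$-vector spaces. A poset $P$ is regarded as a category (a unique morphism $p\to q$ iff $p\le q$). A $P$-module is a functor $M:P\to\mathbf{vec}$. A nonempty subset $I\subset P$ is connected if any two elements of $I$ are joined by a finite sequence in $I$ whose consecutive elements are comparable; $\mathrm{Con}(P)$ is the set of connected subposets of $P$. An interval of $P$ is a connected subset that is also convex ($p,r\in I$, $p\le q\le r$ imply $q\in I$). $\mathrm{Int}(P)\subset\mathrm{Con}(P)$ is the set of intervals. For a connected poset $P$ and a $P$-module $M$, $\mathrm{rk}(M)$ is the rank of the canonical map $\varprojlim M\to\varinjlim M$, namely $i_p\circ\pi_p$ for any $p\in P$ ($\pi_p:\varprojlim M\to M_p$, $i_p:M_p\to\varinjlim M$ the structure maps). For $I\in\mathrm{Con}(P)$, $\mathrm{rk}_M(I):=\mathrm{rk}(M|_I)$. The Con-GRI and Int-GRI are $\mathrm{rk}_M^{\mathrm{Con}}:=\mathrm{rk}_M$ on $\mathrm{Con}(P)$ and $\mathrm{rk}_M^{\mathrm{Int}}:=\mathrm{rk}_M|_{\mathrm{Int}(P)}$. For $\mathcal J\subset\mathrm{Con}(P)$, let $\mathrm{rk}_M^{\mathcal J}:=\mathrm{rk}_M|_{\mathcal J}$. It is Möbius invertible if there are $\mathcal I\subset\mathcal J$ and $d:\mathcal I\to\mathbb Z$ with $\mathrm{rk}_M(I)=\sum_{J\supset I,\,J\in\mathcal I}d(J)$ for every $I\in\mathcal J$, the sum having only finitely many nonzero summands. In that case the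 function $d$, extended by $0$ to $\mathcal J$, is unique; it is called the Möbius inversion of $\mathrm{rk}_M^{\mathcal J}$. (When the underlying poset is finite, $\mathrm{rk}_N^{\mathrm{Con}}$ and $\mathrm{rk}_N^{\mathrm{Int}}$ are always Möbius invertible.) An order-preserving map $\pi:P\to Q$ is a covering if $\pi$ is surjective and for each $J\in\mathrm{Con}(Q)$, $\pi^{-1}(J)$ is a disjoint union of connected subposets $I\subset P$ (its connected components) such that $\pi(I)=J$. $\pi$ is Con-rank-preserving (resp. Int-rank-preserving) from $M$ to $N$ if $\mathrm{rk}_M(I)=\mathrm{rk}_N(\pi(I))$ for all $I\in\mathrm{Con}(P)$ (resp. $I\in\mathrm{Int}(P)$). $\pi$ is interval-preserving if $\pi(I)\in\mathrm{Int}(Q)$ for all $I\in\mathrm{Int}(P)$. *)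

(* Defs.v *)
From HB Require Import structures.
From mathcomp Require Import all_boot all_order all_algebra.
From mathcomp Require Import generic_quotient ring_quotient.
From mathcomp Require Import finmap.
From mathcomp Require Import boolp classical_sets functions cardinality fsbigop.

Set Implicit Arguments.
Unset Strict Implicit.
Unset Printing Implicit Defensive.

Import Order.TTheory GRing.Theory.

Local Open Scope classical_set_scope.
Local Open Scope ring_scope.

Section Subsets.
Context {d : Order.disp_t} {P : porderType d}.
Implicit Types (A C I : set P) (x y : P).

Definition zigzag A x y :=
  exists s : seq P, [/\ path (fun a b => a >=< b)%O x s,
                        last x s = y &
                        forall z, z \in x :: s -> A z].

Definition connected_set I :=
  I !=set0 /\ forall x y, I x -> I y -> zigzag I x y.

Definition convex_set I :=
  forall p q r, I p -> I r -> (p <= q)%O -> (q <= r)%O -> I q.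

Definition interval_set I := connected_set I /\ convex_set I.

Definition is_component A C := exists2 x, A x & C = [set y | zigzag A x y].

End Subsets.

Definition Con {d} (P : porderType d) : set (set P) := [set I | connected_set I].
Definition Int {d} (P : porderType d) : set (set P) := [set I | interval_set I].
Arguments Con {d} P.
Arguments Int {d} P.

Definition subposet {d} {P : porderType d} (I : set P) : Type := {p : P | p \in I}.
HB.instance Definition _ d (P : porderType d) (I : set P) :=
  SubChoice.on (subposet I).
HB.instance Definition _ d (P : porderType d) (I : set P) :=
  [SubChoice_isSubPOrder of subposet I by <: with d].

Section LinearRank.
Context {k : fieldType}.

Definition lincomb (V : lmodType k) n (e : 'I_n -> V) (c : 'rV[k]_n) : V :=
  \sum_i c ord0 i *: e i.

Definition is_basis (V : lmodType k) (S : set V) n (e : 'I_n -> V) :=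
  set_bij [set: 'rV[k]_n] S (lincomb e).

Definition has_dim (V : lmodType k) (S : set V) (n : nat) :=
  exists e : 'I_n -> V, is_basis S e.

(* The dimension of the image. The default value of [xget] matters only when
   the image is infinite-dimensional, which does not happen for the maps
   considered here; see [has_dim_unique] and [has_dim_canonical]. *)
Definition lin_rank (U V : lmodType k) (f : {linear U -> V}) : nat :=
  xget 0%N (has_dim (range f)).

Lemma lincomb_is_linear (V : lmodType k) n (e : 'I_n -> V) : linear (lincomb e).
Proof.
move=> a u v; rewrite /lincomb scaler_sumr -big_split /=.
by apply: eq_bigr => i _; rewrite !mxE scalerDl scalerA.
Qed.
HB.instance Definition _ (V : lmodType k) n (e : 'I_n -> V) :=
  GRing.isLinear.Build k 'rV[k]_n V _ (lincomb e) (lincomb_is_linear e).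

Lemma lincomb_delta (V : lmodType k) n (e : 'I_n -> V) i :
  lincomb e (delta_mx ord0 i) = e i.
Proof.
rewrite /lincomb (bigD1 i) //= big1 => [|j ji].
  by rewrite mxE !eqxx scale1r addr0.
by rewrite mxE eqxx /= (negPf ji) scale0r.
Qed.

Lemma has_dim_le (V : lmodType k) (S : set V) m n :
  has_dim S m -> has_dim S n -> (m <= n)%N.
Proof.
move=> [e [eS einj _]] [f [fS _ fsurj]].
have /choice[g gP] i : exists c, lincomb f c = e i.
  have /fsurj[c _ <-] : S (e i) by rewrite -lincomb_delta; apply: eS.
  by exists c.
pose A := \matrix_i g i.
have eA u : lincomb e u = lincomb f (u *m A).
  rewrite mulmx_sum_row linear_sum; apply: eq_bigr => i _.
  by rewrite linearZ /= rowK gP.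
rewrite -[m](mxrank1 k) -[1%:M]mulmx1.
have /row_freeP[B AB] : row_free A.
  apply/inj_row_free => v vA; apply: einj; rewrite ?inE //.
  by rewrite eA vA !linear0.
by rewrite mulmx1 -AB (leq_trans (mxrankM_maxl _ _)) // rank_leq_col.
Qed.

Lemma has_dim_unique (V : lmodType k) (S : set V) m n :
  has_dim S m -> has_dim S n -> m = n.
Proof. by move=> hm hn; apply/eqP; rewrite eqn_leq !(@has_dim_le _ S). Qed.

Lemma has_dim_factor (U V : lmodType k) (W : vectType k)
    (h : {linear U -> W}) (g : {linear W -> V}) :
  exists n, has_dim (range (g \o h)) n.
Proof.
pose free n := exists u : 'I_n -> U, injective (lincomb (g \o h \o u)).
have freeP : exists n, `[< free n >].
  exists 0%N; apply/asboolP; exists (fun=> 0) => c c' _.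
  by apply/rowP => -[].
have free_le n : `[< free n >] -> (n <= \dim {:W})%N.
  move=> /asboolP[u uinj].
  have uinj' : injective (lincomb (h \o u)).
    move=> c c' cc'; apply: uinj.
    have E c0 : lincomb (g \o h \o u) c0 = g (lincomb (h \o u) c0).
      by rewrite /lincomb linear_sum; apply: eq_bigr => i _; rewrite linearZ.
    by rewrite !E cc'.
  pose X := [tuple h (u i) | i < n].
  have : vector.free X.
    apply/vector.freeP => c c0 i.
    have : \row_j c j = 0.
      apply: uinj'; rewrite linear0 -c0; apply: eq_bigr => j _.
      by rewrite mxE /= (nth_map j) ?size_enum_ord // nth_ord_enum.
    by move/rowP => /(_ i); rewrite !mxE.
  rewrite /vector.free size_tuple => /eqP <-; exact: dimvS (subvf _).
case: (ex_maxnP freeP free_le) => n /asboolP[u uinj] nmax.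
exists n, (g \o h \o u); split.
- move=> c _ /=; exists (\sum_i c ord0 i *: u i) => //=.
  by rewrite !linear_sum; apply: eq_bigr => i _; rewrite !linearZ.
- by move=> c c' _ _ /uinj.
move=> _ [x _ <-]; apply: contrapT => xN.
suff : `[< free n.+1 >] by move=> /nmax; rewrite ltnn.
apply/asboolP.
pose u' i := oapp u x (unlift (@ord_max n) i); exists u'.
have u'E (c : 'rV_n.+1) : lincomb (g \o h \o u') c =
    lincomb (g \o h \o u) (\row_i c ord0 (lift ord_max i)) +
    c ord0 ord_max *: g (h x).
  rewrite /lincomb big_ord_recr /= /u' unlift_none; congr (_ + _).
  apply: eq_bigr => i _; rewrite mxE.
  have -> : widen_ord (leqnSn n) i = lift ord_max i.
    by apply: val_inj; exact/esym/lift_max.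
  by rewrite liftK.
apply: raddf_inj => c c0; move: (etrans (esym (u'E c)) c0) => /eqP.
have [cn0|cn0] := eqVneq (c ord0 ord_max) 0.
  rewrite cn0 scale0r addr0 => /eqP cl0.
  have {cl0} cl0 : \row_i c ord0 (lift ord_max i) = 0.
    by apply: uinj; rewrite cl0 linear0.
  apply/rowP => i; rewrite mxE; case: (unliftP ord_max i) => [j ->|-> //].
  by move/rowP: cl0 => /(_ j); rewrite !mxE.
rewrite addrC addr_eq0 => /eqP xE; case: xN.
exists (- (c ord0 ord_max)^-1 *: \row_i c ord0 (lift ord_max i)) => //.
by rewrite linearZ /= scaleNr -scalerN -xE scalerK.
Qed.

End LinearRank.

Section LmodQuotient.
Context {k : fieldType} {V : lmodType k} {S : {pred V}}.
Variable S_sub : submod_closed S.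
Local Open Scope quotient_scope.

Let subspace : {pred V} := let _ := S_sub in S.
HB.instance Definition _ := GRing.isSubmodClosed.Build k V subspace S_sub.

Definition lmod_quot := Quotient.quot subspace.
HB.instance Definition _ := GRing.Zmodule.on lmod_quot.

Definition lmod_proj (v : V) : lmod_quot := \pi_(Quotient.quot subspace) v.

Lemma lmod_projP u v : (lmod_proj u = lmod_proj v) <-> (u - v \in S).
Proof.
have -> : (u - v \in S) = (lmod_proj u == lmod_proj v).
  exact: (Quotient.idealrBE subspace u v).
by split => /eqP.
Qed.

Lemma lmod_projK (x : lmod_quot) : lmod_proj (repr x) = x.
Proof. exact: reprK. Qed.

Lemma lmod_projD u v : lmod_proj (u + v) = lmod_proj u + lmod_proj v.
Proof. by rewrite /lmod_proj; exact: (raddfD (\pi_(Quotient.quot subspace))). Qed.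

Definition lmod_quot_scale (a : k) (x : lmod_quot) := lmod_proj (a *: repr x).

Lemma lmod_projZ a v : lmod_proj (a *: v) = lmod_quot_scale a (lmod_proj v).
Proof.
apply/lmod_projP; rewrite -scalerBr (@rpredZ _ _ subspace) //.
by apply/lmod_projP; rewrite lmod_projK.
Qed.

Fact lmod_quot_scaleA a b x :
  lmod_quot_scale a (lmod_quot_scale b x) = lmod_quot_scale (a * b) x.
Proof. by rewrite -[x]lmod_projK -!lmod_projZ scalerA. Qed.
Fact lmod_quot_scale1 : left_id 1 lmod_quot_scale.
Proof. by move=> x; rewrite -[x]lmod_projK -!lmod_projZ scale1r. Qed.
Fact lmod_quot_scaleDr : right_distributive lmod_quot_scale +%R.
Proof.
move=> a x y; rewrite -[x]lmod_projK -[y]lmod_projK.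
by rewrite -lmod_projD -!lmod_projZ scalerDr lmod_projD.
Qed.
Fact lmod_quot_scaleDl x : {morph lmod_quot_scale^~ x : a b / a + b}.
Proof.
by move=> a b; rewrite -[x]lmod_projK -!lmod_projZ scalerDl lmod_projD.
Qed.
HB.instance Definition _ := GRing.Zmodule_isLmodule.Build k lmod_quot
  lmod_quot_scaleA lmod_quot_scale1 lmod_quot_scaleDr lmod_quot_scaleDl.

Fact lmod_proj_is_linear : linear lmod_proj.
Proof. by move=> a u v; rewrite lmod_projD lmod_projZ. Qed.
HB.instance Definition _ :=
  GRing.isLinear.Build k V lmod_quot _ lmod_proj lmod_proj_is_linear.

End LmodQuotient.

Record pmodule (k : fieldType) d (P : porderType d) := PModule {
  pm_space :> P -> vectType k;
  pm_map : forall p q, (p <= q)%O -> 'Hom(pm_space p, pm_space q);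
  pm_map_id : forall p (pp : (p <= p)%O) v, pm_map pp v = v;
  pm_map_comp : forall p q r (pq : (p <= q)%O) (qr : (q <= r)%O)
    (pr : (p <= r)%O) v, pm_map pr v = pm_map qr (pm_map pq v) }.

Definition restrict {k : fieldType} {d} {P : porderType d}
    (M : pmodule k P) (I : set P) : pmodule k (subposet I) :=
  @PModule k d (subposet I)
    (fun p => M (val p))
    (fun p q (pq : (p <= q)%O) => @pm_map k d P M (val p) (val q) pq)
    (fun p pp v => @pm_map_id k d P M (val p) pp v)
    (fun p q r pq qr pr v =>
       @pm_map_comp k d P M (val p) (val q) (val r) pq qr pr v).

Section LimitColimit.
Context {k : fieldType} {d : Order.disp_t} {P : porderType d}.
Variable M : pmodule k P.

Definition sections : Type := forall p : P, M p.
HB.instance Definition _ := gen_eqMixin sections.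
HB.instance Definition _ := gen_choiceMixin sections.

Let add (s t : sections) : sections := fun p => s p + t p.
Let opp (s : sections) : sections := fun p => - s p.
Let zero : sections := fun p => 0.
Let scale (a : k) (s : sections) : sections := fun p => a *: s p.
Fact sections_addA : associative add.
Proof. by move=> s t u; apply: functional_extensionality_dep => p; exact: addrA. Qed.
Fact sections_addC : commutative add.
Proof. by move=> s t; apply: functional_extensionality_dep => p; exact: addrC. Qed.
Fact sections_add0 : left_id zero add.
Proof. by move=> s; apply: functional_extensionality_dep => p; exact: add0r. Qed.
Fact sections_addN : left_inverse zero opp add.
Proof. by move=> s; apply: functional_extensionality_dep => p; exact: addNr. Qed.
HB.instance Definition _ := GRing.isZmodule.Build sections
  sections_addA sections_addC sections_add0 sections_addN.

Fact sections_scaleA a b s : scale a (scale b s) = scale (a * b) s.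
Proof. by apply: functional_extensionality_dep => p; exact: scalerA. Qed.
Fact sections_scale1 : left_id 1 scale.
Proof. by move=> s; apply: functional_extensionality_dep => p; exact: scale1r. Qed.
Fact sections_scaleDr : right_distributive scale +%R.
Proof. by move=> a s t; apply: functional_extensionality_dep => p; exact: scalerDr. Qed.
Fact sections_scaleDl s : {morph scale^~ s : a b / a + b}.
Proof. by move=> a b; apply: functional_extensionality_dep => p; exact: scalerDl. Qed.
HB.instance Definition _ := GRing.Zmodule_isLmodule.Build k sections
  sections_scaleA sections_scale1 sections_scaleDr sections_scaleDl.

Definition compatible : pred sections :=
  [pred s : sections | `[< forall p q (pq : (p <= q)%O), pm_map M pq (s p) = s q >]].

Fact compatible_submod_closed : submod_closed compatible.
Proof.
split=> [|a s t /asboolP sM /asboolP tM]; apply/asboolP => p q pq.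
  by rewrite linear0.
by rewrite linearP /= sM tM.
Qed.
HB.instance Definition _ :=
  GRing.isSubmodClosed.Build k sections compatible compatible_submod_closed.

Definition lim : Type := {s : sections | compatible s}.
HB.instance Definition _ := SubChoice.on lim.
HB.instance Definition _ := [SubChoice_isSubLmodule of lim by <:].

Definition lim_proj (p : P) (s : lim) : M p := val s p.
Fact lim_proj_is_linear p : linear (lim_proj p).
Proof. by move=> a s t. Qed.
HB.instance Definition _ p :=
  GRing.isLinear.Build k lim (M p) _ (lim_proj p) (lim_proj_is_linear p).

Definition finitely_supported : pred sections :=
  [pred s : sections | `[< finite_set [set p | s p != 0] >]].

Fact finitely_supported_submod_closed : submod_closed finitely_supported.
Proof.
split=> [|a s t /asboolP sM /asboolP tM]; apply/asboolP.
  by apply: (sub_finite_set _ (finite_set0 _)) => p /=; rewrite eqxx.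
have fin : finite_set ([set p | s p != 0] `|` [set p | t p != 0]).
  by rewrite finite_setU.
apply: (sub_finite_set _ fin) => p /=; case: (eqVneq (s p) 0) => [sp0|]; last by left.
case: (eqVneq (t p) 0) => [tp0|]; last by right.
suff -> : (a *: s + t) p = 0 by rewrite eqxx.
by rewrite -[LHS]/(a *: s p + t p) sp0 tp0 scaler0 addr0.
Qed.
HB.instance Definition _ := GRing.isSubmodClosed.Build k sections
  finitely_supported finitely_supported_submod_closed.

Definition dsum : Type := {s : sections | finitely_supported s}.
HB.instance Definition _ := SubChoice.on dsum.
HB.instance Definition _ := [SubChoice_isSubLmodule of dsum by <:].

Definition delta (p : P) (v : M p) : sections := fun q =>
  if p =P q is ReflectT e then ecast q (M q) e v else 0.

Lemma delta_same p v : delta v p = v :> M p.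
Proof. by rewrite /delta; case: eqP => // e; rewrite eq_axiomK. Qed.
Lemma delta_neq p q (v : M p) : p != q -> delta v q = 0.
Proof. by rewrite /delta; case: eqP. Qed.

Fact delta_finitely_supported p (v : M p) : finitely_supported (delta v).
Proof.
apply/asboolP; apply: (sub_finite_set _ (finite_set1 p)) => q /=.
by apply: contra_neqP => /eqP qp; apply: delta_neq; rewrite eq_sym.
Qed.

Definition dsum_inj (p : P) (v : M p) : dsum := Sub (delta v) (delta_finitely_supported v).
Fact dsum_inj_is_linear p : linear (@dsum_inj p).
Proof.
move=> a v w; apply: val_inj; apply: functional_extensionality_dep => q /=.
rewrite -[RHS]/(a *: delta v q + delta w q).
case: (eqVneq p q) => [<-|pq]; first by rewrite !delta_same.
by rewrite !delta_neq // scaler0 addr0.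
Qed.
HB.instance Definition _ p :=
  GRing.isLinear.Build k (M p) dsum _ (@dsum_inj p) (@dsum_inj_is_linear p).

(* The smallest subspace of the direct sum identifying [v : M p] with its
   image in [M q] whenever [p <= q]. *)
Definition colim_rel : pred dsum :=
  [pred w : dsum | `[< forall S : {pred dsum}, submod_closed S ->
    (forall p q (pq : (p <= q)%O) (v : M p),
       dsum_inj (pm_map M pq v) - dsum_inj v \in S) ->
    w \in S >]].

Fact colim_rel_submod_closed : submod_closed colim_rel.
Proof.
split=> [|a s t /asboolP sR /asboolP tR]; apply/asboolP => S Ssub SM.
  by case: Ssub.
by case: (Ssub) => _; apply; [exact: sR|exact: tR].
Qed.
Definition colim : lmodType k := lmod_quot colim_rel_submod_closed.

Definition colim_inj (p : P) : M p -> colim :=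
  lmod_proj colim_rel_submod_closed \o @dsum_inj p.
HB.instance Definition _ p := GRing.Linear.on (@colim_inj p).

Definition canonical_map (p : P) : lim -> colim := @colim_inj p \o lim_proj p.
HB.instance Definition _ p := GRing.Linear.on (canonical_map p).

(* The set of values is a singleton when [P] is connected; see [rkE]. *)
Definition rk : nat := xget 0%N (range (fun p => lin_rank (canonical_map p))).

Lemma lim_projE p q (pq : (p <= q)%O) s : pm_map M pq (lim_proj p s) = lim_proj q s.
Proof. by case: s => s sM; have /asboolP := sM; apply. Qed.

Lemma colim_injE p q (pq : (p <= q)%O) v :
  colim_inj (pm_map M pq v) = colim_inj v.
Proof. by apply/lmod_projP/asboolP => S _; apply. Qed.

Lemma canonical_map_eq p q : zigzag [set: P] p q -> canonical_map p =1 canonical_map q.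
Proof.
have le_eq x y : (x <= y)%O -> canonical_map x =1 canonical_map y.
  by move=> xy s; rewrite /canonical_map /= -(lim_projE xy) colim_injE.
move=> [s [+ + _]]; elim: s p => [|x s IH] p /=; first by move=> _ ->.
move=> /andP[px xs] sq w; rewrite -(IH x xs sq).
by case/orP: px => le; [rewrite (le_eq _ _ le)|rewrite -(le_eq _ _ le)].
Qed.

Lemma has_dim_canonical p : exists n, has_dim (range (canonical_map p)) n.
Proof. exact: has_dim_factor. Qed.

Lemma rkE p : connected_set [set: P] -> rk = lin_rank (canonical_map p).
Proof.
move=> [_ Pconn]; rewrite /rk; case: xgetP => [_ -> [q _ <-]|/(_ (lin_rank (canonical_map p)))].
  rewrite /lin_rank; suff -> : range (canonical_map q) = range (canonical_map p) by [].
  by apply: eq_imagel => s _; apply/canonical_map_eq/Pconn.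
by case; exists p.
Qed.

End LimitColimit.

Definition rk_on {k : fieldType} {d} {P : porderType d} (M : pmodule k P)
  (I : set P) : nat := rk (restrict M I).

Lemma connected_subposet {d} {P : porderType d} (I : set P) :
  connected_set I -> connected_set [set: subposet I].
Proof.
move=> [[x Ix] Iconn]; split; first by exists (exist _ x (mem_set Ix)).
move=> [p pI] [q qI] _ _.
have [s [+ + sI]] := Iconn p q (set_mem pI) (set_mem qI).
elim: s p pI sI => [|y s IH] p pI sI /=.
  by move=> _ pq; exists [::]; split=> //=; exact: val_inj.
move=> /andP[py ys] sq.
have Iy : I y by apply: sI; rewrite !inE eqxx orbT.
have [z zs|t [yt tq _]] := IH y (mem_set Iy) _ ys sq.
  by apply: sI; rewrite inE zs orbT.
by exists (exist _ y (mem_set Iy) :: t); split=> //=; rewrite yt andbT.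
Qed.

Section Mobius.
Context {d : Order.disp_t} {P : porderType d}.
Implicit Types (J I : set (set P)) (f : set P -> nat) (e : set P -> int).

(* Only the values of [f] on [J] and of [e] on [I] are relevant. *)
Definition mobius_system J f I e :=
  I `<=` J /\
  forall X, J X ->
    finite_set [set Y | [/\ I Y, X `<=` Y & e Y != 0]] /\
    (f X)%:Z = \sum_(Y \in [set Y | I Y /\ X `<=` Y]) e Y.

Definition mobius_invertible J f := exists I e, mobius_system J f I e.

(* The extension by zero of [e : I -> int]; it does not depend on the choice of
   [I] and [e], see [mobius_inversion_unique]. *)
Definition is_mobius_inversion J f (e' : set P -> int) :=
  exists I e, mobius_system J f I e /\ e' = patch (fun=> 0) I e.

Definition mobius_inversion J f : set P -> int :=
  xget (fun=> 0) (is_mobius_inversion J f).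

Lemma is_mobius_inversionP J f e : is_mobius_inversion J f e ->
  (forall X, e X != 0 -> J X) /\
  forall X, J X -> finite_set [set Y | X `<=` Y /\ e Y != 0] /\
    (f X)%:Z = \sum_(Y \in [set Y | X `<=` Y /\ e Y != 0]) e Y.
Proof.
move=> [I [e0 [[IJ sys] ->]]].
have patchN0 Y : (patch (fun=> 0) I e0 Y != 0) = (Y \in I) && (e0 Y != 0).
  by rewrite /patch; case: ifP => // _; rewrite eqxx.
split=> [X|X /sys[fin ->]]; first by rewrite patchN0 => /andP[/set_mem/IJ].
have E : [set Y | X `<=` Y /\ patch (fun=> 0) I e0 Y != 0] =
         [set Y | [/\ I Y, X `<=` Y & e0 Y != 0]].
  apply/seteqP; split=> Y /=.
    by rewrite patchN0 => -[XY /andP[/set_mem]].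
  by move=> [IY XY eY]; rewrite patchN0 mem_set.
split; first by rewrite E.
rewrite E.
transitivity (\sum_(Y \in [set Y | [/\ I Y, X `<=` Y & e0 Y != 0]]) e0 Y).
  apply/esym/fsbig_widen => [Y [] //|Y [[IY XY]]] /= nY.
  by apply: contra_notP nY => /eqP eY.
by apply: eq_fsbigr => Y; rewrite inE => -[IY _ _]; rewrite patchT ?inE.
Qed.

Lemma mobius_inversion_unique J f e1 e2 :
  is_mobius_inversion J f e1 -> is_mobius_inversion J f e2 -> e1 = e2.
Proof.
move=> /is_mobius_inversionP[supp1 sys1] /is_mobius_inversionP[supp2 sys2].
pose F X := [set Y | X `<=` Y /\ e1 Y != 0] `|` [set Y | X `<=` Y /\ e2 Y != 0].
suff main : forall n X, J X -> (#|` fset_set (F X) | <= n)%N -> e1 X = e2 X.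
  apply/funext => X; case: (pselect (J X)) => [JX|nJ]; first exact: main _ _ JX (leqnn _).
  have [e10|/supp1//] := eqVneq (e1 X) 0.
  by have [e20|/supp2//] := eqVneq (e2 X) 0; rewrite e10 e20.
have finF Y : J Y -> finite_set (F Y).
  by move=> JY; rewrite finite_setU; split; [case: (sys1 Y JY)|case: (sys2 Y JY)].
have FJ (X Y : set P) : F X Y -> J Y by case=> -[_]; [exact: supp1|exact: supp2].
have sumF X : J X -> \sum_(Y \in F X) e1 Y = \sum_(Y \in F X) e2 Y.
  move=> JX; have [_ s1] := sys1 X JX; have [_ s2] := sys2 X JX.
  have W e : [set Y | X `<=` Y /\ e Y != 0] `<=` F X ->
      \sum_(Y \in [set Y | X `<=` Y /\ e Y != 0]) e Y = \sum_(Y \in F X) e Y.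
    move=> eF; apply: fsbig_widen => // Y [FY nY].
    apply: contra_notP nY => /eqP eY; split=> //.
    by case: FY => -[].
  by rewrite -!W -?s1 -?s2 // => Y; [right|left].
have eqN X : ~ F X X -> e1 X = e2 X.
  move=> nFX; have [e10|e1X] := eqVneq (e1 X) 0; last by exfalso; apply: nFX; left; split.
  by have [e20|e2X] := eqVneq (e2 X) 0; [rewrite e10 e20|exfalso; apply: nFX; right; split].
elim=> [|n IH] X JX cardF; have [FX|] := pselect (F X X); [|exact: eqN| |exact: eqN].
  move: cardF; rewrite leqn0 => /eqP/cardfs0_eq F0.
  have : X \in fset_set (F X) by rewrite in_fset_set ?mem_set //; exact: finF.
  by rewrite F0.
have := sumF X JX; rewrite !(fsbigD1 X _ _ (finF X JX) FX) /=.
have -> : \sum_(Y \in F X `\ X) e1 Y = \sum_(Y \in F X `\ X) e2 Y.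
  apply: eq_fsbigr => Y; rewrite inE => -[FY YX]; apply: IH; first exact: FJ FY.
  rewrite -ltnS (leq_trans _ cardF) //; apply: fproper_ltn_card.
  have XY : X `<=` Y by case: FY => -[].
  rewrite fproperEneq; apply/andP; split; last first.
    rewrite -fset_set_sub; [|exact/finF/(FJ X)|exact: finF].
    by move=> Z [] [YZ eZ]; [left|right]; split=> //; exact: subset_trans YZ.
  apply/eqP => EF; have : F Y X.
    rewrite -(fset_setK (finF Y (FJ _ _ FY))) EF fset_setK //; exact: finF.
  by case=> -[YX' _]; apply: YX; apply/seteqP.
exact: addIr.
Qed.

End Mobius.

Section Maps.
Context {d d' : Order.disp_t} {P : porderType d} {Q : porderType d'}.
Variable f : P -> Q.

(* Every subset is the disjoint union of its components, so the requirement on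
   the preimage of a connected set only bears on the images of the components. *)
Definition covering :=
  [/\ {homo f : x y / (x <= y)%O},
      forall q, exists p, f p = q &
      forall J, Con Q J -> forall I, is_component (f @^-1` J) I -> f @` I = J].

Definition rank_preserving {k : fieldType} (J : set (set P))
    (M : pmodule k P) (N : pmodule k Q) :=
  forall I, J I -> rk_on M I = rk_on N (f @` I).

Definition interval_preserving := forall I, Int P I -> Int Q (f @` I).

End Maps.

(* Main.v *)
Require Import Defs.
From mathcomp Require Import all_boot all_order all_algebra.
From mathcomp Require Import boolp classical_sets.
From mathcomp Require Import functions cardinality fsbigop.

(** For X in the chosen class of connected subsets of P, the components Y of
    fibres [f @^-1` J] with X contained in Y are in bijection, through direct
    image, with the sets J containing [f @` X]: the inverse sends J to the
    component of [f @^-1` J] containing X, and the covering property says that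
    this component maps onto J.  Pulling the Möbius inversion on Q back along
    this bijection gives a solution on P, and solutions are unique. *)

Set Implicit Arguments.
Unset Strict Implicit.
Unset Printing Implicit Defensive.

Import Order.TTheory GRing.Theory.

Local Open Scope classical_set_scope.
Local Open Scope ring_scope.

(** * Zigzags and connected components *)

Section Zigzag.
Context {d : Order.disp_t} {P : porderType d}.
Implicit Types (A B C X : set P) (x y z : P).

Lemma zigzag_refl A x : A x -> zigzag A x x.
Proof. by move=> Ax; exists [::]; split=> // z; rewrite inE => /eqP ->. Qed.

Lemma zigzag_cons A x y z :
  A x -> (x >=< y)%O -> zigzag A y z -> zigzag A x z.
Proof.
move=> Ax xy [s [ys sz sA]]; exists (y :: s); split=> //=; first by rewrite xy.
by move=> t; rewrite inE => /orP[/eqP ->|/sA].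
Qed.

(** Induction on a zigzag with its endpoint fixed, so that later arguments need not handle
    sequences. *)
Lemma zigzag_end_ind A y (R : P -> Prop) : (A y -> R y) ->
  (forall x z, A x -> (x >=< z)%O -> zigzag A z y -> R z -> R x) ->
  forall x, zigzag A x y -> R x.
Proof.
move=> Ry RS x [s [+ + +]]; elim: s x => [|z s IH] x /=.
  by move=> _ -> A1; apply/Ry/A1; rewrite mem_head.
move=> /andP[xz zs] sy sA.
have zsA t : t \in z :: s -> A t by move=> ts; apply: sA; rewrite inE ts orbT.
apply: (RS x z) => //; first by apply: sA; rewrite mem_head.
  by exists s.
exact: IH.
Qed.

Lemma zigzag_trans A x y z : zigzag A x y -> zigzag A y z -> zigzag A x z.
Proof.
move=> xy yz; elim/zigzag_end_ind: x / xy => // x w Ax xw _; exact: zigzag_cons.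
Qed.

Lemma zigzag_left A x y : zigzag A x y -> A x.
Proof. by move=> [s [_ _]]; apply; rewrite mem_head. Qed.

Lemma zigzag_sym A x y : zigzag A x y -> zigzag A y x.
Proof.
move=> xy; elim/zigzag_end_ind: x / xy => [|x w Ax xw wy yw].
  exact: zigzag_refl.
apply: (zigzag_trans yw); apply: (@zigzag_cons _ w x) => //.
  exact: zigzag_left wy.
  by rewrite comparable_sym.
exact: zigzag_refl.
Qed.

Lemma zigzag_sub A B x y : A `<=` B -> zigzag A x y -> zigzag B x y.
Proof. by move=> AB [s [xs sy sA]]; exists s; split=> // z /sA/AB. Qed.

(** Every point on a zigzag to the base point [x] is itself joined to [x], so the zigzag stays in
    the component; two points then connect through [x]. *)
Lemma component_connected A C : is_component A C -> connected_set C.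
Proof.
move=> [x Ax ->]; split; first by exists x; exact: zigzag_refl.
have to_x y : zigzag A y x -> zigzag [set z | zigzag A x z] y x.
  move=> yx; elim/zigzag_end_ind: y / yx => [_|y w Ay yw wx].
    by apply: zigzag_refl; exact: zigzag_refl.
  apply: zigzag_cons => //; apply/zigzag_sym; exact: zigzag_cons yw wx.
move=> y z /zigzag_sym/to_x yx /zigzag_sym/to_x/zigzag_sym.
exact: zigzag_trans.
Qed.

Lemma component_convex A C : convex_set A -> is_component A C -> convex_set C.
Proof.
move=> Aconv [x _ ->] p q r xp xr pq qr.
have Ap := zigzag_left (zigzag_sym xp).
have Aq : A q by apply: Aconv pq qr => //; exact: zigzag_left (zigzag_sym xr).
apply: (zigzag_trans xp); apply: (zigzag_cons Ap (le_comparable pq)).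
exact: zigzag_refl.
Qed.

Lemma component_eq A C C' x :
  is_component A C -> is_component A C' -> C x -> C' x -> C = C'.
Proof.
move=> [y _ ->] [z _ ->] yx zx.
by apply/seteqP; split=> t /=; apply: zigzag_trans;
  [apply: (zigzag_trans zx)|apply: (zigzag_trans yx)]; apply: zigzag_sym.
Qed.

Lemma connected_sub_component A X : connected_set X -> X `<=` A ->
  exists2 C, is_component A C & X `<=` C.
Proof.
move=> [[x Xx] Xconn] XA; exists [set y | zigzag A x y].
  by exists x => //; exact: XA.
by move=> y Xy; apply: (zigzag_sub XA); exact: Xconn.
Qed.

End Zigzag.

(** * Images and preimages under monotone maps *)

Section Images.
Context {d d' : Order.disp_t} {P : porderType d} {Q : porderType d'}.
Variable f : P -> Q.
Hypothesis f_homo : {homo f : x y / (x <= y)%O}.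

Lemma homo_image_connected X : connected_set X -> connected_set (f @` X).
Proof.
move=> [[x0 Xx0] Xconn]; split; first by exists (f x0), x0.
move=> _ _ [x Xx <-] [y Xy <-].
have xy := Xconn _ _ Xx Xy; elim/(@zigzag_end_ind _ P): x / xy {Xx} => [_|x z Xx xz _].
  by apply: zigzag_refl; exists y.
apply: zigzag_cons; first by exists x.
by case/orP: xz => /f_homo le; apply/orP; [left|right].
Qed.

Lemma homo_preimage_convex J : convex_set J -> convex_set (f @^-1` J).
Proof.
by move=> Jconv p q r Jp Jr /f_homo pq /f_homo; apply: Jconv pq.
Qed.

End Images.

(** * Möbius inversions, and their existence over a finite poset *)

Lemma mobius_inversionE d (P : porderType d) (J : set (set P)) h e :
  is_mobius_inversion J h e -> mobius_inversion J h = e.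
Proof.
move=> eP; apply: (mobius_inversion_unique _ eP).
by apply: (@xgetPex (set P -> int)); exists e.
Qed.

Lemma finite_powerset (T : finType) (S : set (set T)) : finite_set S.
Proof.
apply: (@sub_finite_set _ _ ((fun A : {set T} => [set` A]) @` setT)).
  move=> X _; exists [set x | x \in X]%SET => //.
  by apply/seteqP; split=> x /=; rewrite inE; [exact: set_mem|exact: mem_set].
exact/finite_image/finite_finset.
Qed.

(* The system is triangular: the equation at X determines [e X] from the values
   of [e] at strictly larger sets, which have a smaller complement. *)
Lemma mobius_invertible_finite d (Q : finPOrderType d) (J : set (set Q))
    (h : set Q -> nat) : mobius_invertible J h.
Proof.
pose codim (X : set Q) := #|[set x | x \notin X]%SET|.
pose up (X : set Q) := [set Y | J Y /\ X `<=` Y].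
have codim_lt X Y : X `<=` Y -> Y <> X -> (codim Y < codim X)%N.
  move=> XY YX; apply: proper_card; apply/properP; split.
    by apply/fintype.subsetP => x; rewrite !inE; apply: contra => /set_mem/XY/mem_set.
  have [x Yx nXx] : exists2 x, Y x & ~ X x.
    apply: contrapT => no; apply: YX; apply/seteqP; split=> // x Yx.
    by apply: contrapT => nXx; apply: no; exists x.
  by exists x; rewrite !inE; [rewrite memNset|rewrite negbK mem_set].
(* The induction is on a bound for the codimension; [#|Q|.+1] exceeds every codimension. *)
suff [e eP] : exists e : set Q -> int, forall X, J X ->
    (codim X < #|Q|.+1)%N -> (h X)%:Z = \sum_(Y \in up X) e Y.
  exists J, e; split=> // X JX; split; first exact: finite_powerset.
  by apply: eP => //; rewrite ltnS max_card.
elim: #|Q|.+1 => [|n [e IH]]; first by exists (fun=> 0).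
(* Only values in codimension exactly [n] are reset; the equations already solved involve smaller
   codimensions and survive. *)
exists (fun X => if codim X == n then (h X)%:Z - \sum_(Y \in up X `\ X) e Y
                 else e X) => X JX.
rewrite ltnS leq_eqVlt => /orP[/eqP Xn|Xn].
  rewrite (fsbigD1 X) //=; [|exact: finite_powerset|by split].
  rewrite Xn eqxx; rewrite [X in _ + X](_ : _ = \sum_(Y \in up X `\ X) e Y).
    by rewrite subrK.
  apply: eq_fsbigr => Y /set_mem[[_ XY] YX].
  by rewrite ltn_eqF // -Xn codim_lt.
rewrite IH //; apply: eq_fsbigr => Y /set_mem[_ XY].
suff YX : (codim Y <= codim X)%N by rewrite ltn_eqF // (leq_ltn_trans YX).
by have [->//|/eqP YX] := eqVneq Y X; exact/ltnW/codim_lt.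
Qed.

(** * Transfer along a covering, for classes [JP] and [JQ] covering both Con and Int *)

Section Transfer.
Context {dP dQ : Order.disp_t} {P : porderType dP} {Q : finPOrderType dQ}.
Variables (f : P -> Q) (JP : set (set P)) (JQ : set (set Q)).
Variables (g : set P -> nat) (h : set Q -> nat).
Hypothesis f_cover : covering f.
Hypothesis JP_con : JP `<=` Con P.
Hypothesis JQ_con : JQ `<=` Con Q.
Hypothesis JPQ : forall X, JP X -> JQ (f @` X).
Hypothesis comp_JP : forall J C, JQ J -> is_component (f @^-1` J) C -> JP C.
Hypothesis gh : forall X, JP X -> g X = h (f @` X).

(** The index set of the system on [P]; extension by zero outside it gives the second case of the
    formula. *)
Let sheet (X : set P) := JP X /\ is_component (f @^-1` (f @` X)) X.

Lemma image_sheet_bij X : JP X ->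
  set_bij [set Y | sheet Y /\ X `<=` Y] [set J | JQ J /\ f @` X `<=` J]
          (fun Y => f @` Y).
Proof.
move=> JX; have [[x Xx] _] := JP_con JX; split.
- by move=> Y [[JY _] XY]; split; [exact: JPQ|exact: image_subset].
(* With equal images, both are components of the same fibre, and they share the point [x]. *)
- move=> Y Y' /set_mem[[_ Yc] XY] /set_mem[[_ Y'c] XY'] YY'.
  rewrite -YY' in Y'c.
  exact: component_eq Yc Y'c (XY _ Xx) (XY' _ Xx).
move=> J [JJ XJ].
have [C Cc XC] : exists2 C, is_component (f @^-1` J) C & X `<=` C.
  by apply: connected_sub_component; [exact: JP_con|rewrite -image_sub].
have [_ _ cov] := f_cover; have CJ := cov J (JQ_con JJ) C Cc.
exists C => //; split=> //; split; last by rewrite CJ.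
exact: comp_JP Cc.
Qed.

Lemma mobius_system_pullback e : is_mobius_inversion JQ h e ->
  mobius_system JP g sheet (fun Y => e (f @` Y)).
Proof.
move=> /is_mobius_inversionP[supp eq_h].
split=> [X []//|X JX]; have bij := image_sheet_bij JX; split.
  (* [P] may be infinite: finiteness comes through the bijection with a family of subsets of [Q]. *)
  apply: (@sub_finite_set _ _ [set Y | sheet Y /\ X `<=` Y]).
    by move=> Y [].
  have /eq_finite_set -> : ([set Y | sheet Y /\ X `<=` Y] #=
      [set J | JQ J /\ f @` X `<=` J])%card.
    by apply/card_set_bijP; eexists; exact: bij.
  exact: finite_powerset.
have [_] := eq_h _ (JPQ JX); rewrite gh // => ->.
(* The reindexed sum runs over all members of [JQ] above the image, the equation for [h] only over
   nonzero terms. *)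
rewrite -(reindex_fsbig _ _ _ _ bij); apply: fsbig_widen.
  by move=> J [XJ /supp].
by move=> J [[JJ XJ] nJ] /=; apply: contra_notP nJ => /eqP eJ.
Qed.

Lemma mobius_inversion_covering :
  mobius_invertible JP g /\
  forall X, JP X -> mobius_inversion JP g X =
    if `[< is_component (f @^-1` (f @` X)) X >]
    then mobius_inversion JQ h (f @` X) else 0.
Proof.
have [I [e sys]] := mobius_invertible_finite JQ h.
have inv_h : is_mobius_inversion JQ h (patch (fun=> 0) I e) by exists I, e.
have sys_g := mobius_system_pullback inv_h.
split=> [|X JX]; first by eexists; eexists; exact: sys_g.
rewrite (mobius_inversionE inv_h).
have /mobius_inversionE -> : is_mobius_inversion JP g
  (patch (fun=> 0) sheet (fun Y => patch (fun=> 0) I e (f @` Y))).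
  by eexists; eexists; split; [exact: sys_g|].
(* As [JP X] holds, membership in [sheet] reduces to the component condition. *)
rewrite {1}/patch; case: asboolP => [Xc|nXc]; first by rewrite mem_set.
by rewrite memNset // => -[].
Qed.

End Transfer.

Theorem theorem4 (k : fieldType) (dP dQ : Order.disp_t)
    (P : porderType dP) (Q : finPOrderType dQ)
    (M : pmodule k P) (N : pmodule k Q) (f : P -> Q) :
  covering f ->
  (rank_preserving f (Con P) M N ->
     mobius_invertible (Con P) (rk_on M) /\
     forall I : set P, Con P I ->
       mobius_inversion (Con P) (rk_on M) I =
         if `[< is_component (f @^-1` (f @` I)) I >]
         then mobius_inversion (Con Q) (rk_on N) (f @` I) else 0)
  /\
  (interval_preserving f -> rank_preserving f (Int P) M N ->
     mobius_invertible (Int P) (rk_on M) /\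
     forall I : set P, Int P I ->
       mobius_inversion (Int P) (rk_on M) I =
         if `[< is_component (f @^-1` (f @` I)) I >]
         then mobius_inversion (Int Q) (rk_on N) (f @` I) else 0).
Proof.
move=> f_cover; have [f_homo _ _] := f_cover; split=> [rkMN|f_int rkMN].
  apply: mobius_inversion_covering => //.
    by move=> X; exact: homo_image_connected.
  by move=> J C _; exact: component_connected.
(* Here [f_int] says that images stay in the class; it remains to see that components of preimages
   of intervals are intervals. *)
apply: mobius_inversion_covering => //; [by move=> X []|by move=> X []|].
move=> J C [_ Jconv] Cc; split; first exact: component_connected Cc.
by apply: component_convex Cc; exact: homo_preimage_convex.
Qed.
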